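(* Let $X_i$ and $X_j$ be two observed variables following the linear model $\mathbf{X}=\mathbf{A}\mathbf{S}$. Suppose $X_i$ and $X_j$ follow the One-Latent-Component structure, and $S$ is their only shared latent component, which is non-Gaussian and has unit variance. Then the mixing coefficients between $\{X_i,X_j\}$ and $S$, denoted by $\hat{\alpha}_i$ and $\hat{\alpha}_j$ respectively, can be identified by the fourth-order cumulant as follows: $$\hat{\alpha}_i=\sqrt{\frac{cum(X_i,X_i,X_j,X_j)}{cum(X_i,X_j,X_j,X_j)}\cdot cum(X_i,X_j)},\qquad \hat{\alpha}_j=\frac{cum(X_i,X_j)}{\hat{\alpha}_i}.$$
   Context: Model: $\mathbf{X}=\mathbf{A}\mathbf{S}$, where $\mathbf{X}\in\mathbb{R}^p$ is the random vector of observed variables (mixtures), $\mathbf{S}\in\mathbb{R}^d$ with $d>p$ is a random vector of mutually independent components, and $\mathbf{A}\in\mathbb{R}^{p\times d}$ is the mixing matrix. All variables have zero mean. The mixing coefficient between an observed variable and a component is the corresponding entry of $\mathbf{A}$. A component is shared by $X_i$ and $X_j$ if its mixing coefficients in both are nonzero. $X_i$ and $X_j$ follow the One-Latent-Component structure if they share only one latent (independent) component. $cum(X_{i_1},\dots,X_{i_k})$ is the joint cumulant $\sum_{(D_1,\dots,D_h)}(-1)^{h-1}(h-1)!\,\mathbb{E}[\prod_{j\in D_1}X_j]\cdots\mathbb{E}[\prod_{j\in D_h}X_j]$, the sum being over all partitions $(D_1,\dots,D_h)$ of $\{i_1,\dots,i_k\}$.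
   Formalization: Assumes cum(X_i,X_j,X_j,X_j) is nonzero (a non-Gaussian S can have zero fourth cumulant, giving 0/0) and that X_i, X_j have finite fourth moments; the coefficients are those of S with its sign chosen so that its coefficient in X_i is positive. *)

(* Defs.v *)
From HB Require Import structures.
From mathcomp Require Import all_boot all_order all_algebra.
From mathcomp Require Import all_classical all_reals all_analysis.

Set Implicit Arguments.
Unset Strict Implicit.
Unset Printing Implicit Defensive.
Import Order.TTheory GRing.Theory Num.Theory.
Import numFieldNormedType.Exports.

Local Open Scope classical_set_scope.
Local Open Scope ring_scope.

Definition zero_mean {disp} {T : measurableType disp} {R : realType}
    (P : probability T R) (Y : T -> R) : Prop :=
  Y \in Lfun P 1 /\ ('E_P[Y] = 0)%E.

(* Product rule over every finite subfamily of events [S l \in B l]. *)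
Definition mutually_independent {disp} {T : measurableType disp} {R : realType}
    (P : probability T R) (m : nat) (S : 'I_m -> {RV P >-> R}) : Prop :=
  forall (J : {set 'I_m}) (B : 'I_m -> set R),
    (forall l, measurable (B l)) ->
    P (\bigcap_(l in [set` J]) (S l @^-1` B l)) =
    (\prod_(l in J) P (S l @^-1` B l))%E.
Arguments mutually_independent {disp T R} P {m} S.

(* [s != 0] is needed because [normal_prob m 0] is the uniform law on [0, 1]. *)
Definition gaussian {disp} {T : measurableType disp} {R : realType}
    (P : probability T R) (Y : {RV P >-> R}) : Prop :=
  exists m s : R, s != 0 /\
    forall B : set R, measurable B -> distribution P Y B = normal_prob m s B.
Arguments gaussian {disp T R} P Y.

(* Partitions are taken over the positions 'I_n of the tuple, so that a variable
   occurring several times counts as several elements. The value for n = 0 and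
   for non-integrable products is junk. *)
Definition cum {disp} {T : measurableType disp} {R : realType}
    (P : probability T R) (n : nat) (Y : n.-tuple {RV P >-> R}) : R :=
  \sum_(D : {set {set 'I_n}} | finset.partition D [set: 'I_n]%SET)
    (-1) ^+ #|D|.-1 * (#|D|.-1)`!%:R *
    \prod_(B in D) fine ('E_P[fun w => (\prod_(l in B) tnth Y l w)%R])%E.
Arguments cum {disp T R} P {n} Y.

Definition linear_model {disp} {T : measurableType disp} {R : realType}
    (P : probability T R) (p m : nat) (A : 'M[R]_(p, m))
    (S : 'I_m -> {RV P >-> R}) (X : 'I_p -> {RV P >-> R}) : Prop :=
  forall w : T, \col_q X q w = A *m \col_l S l w.
Arguments linear_model {disp T R} P {p m} A S X.

Definition shared {R : realType} (p m : nat) (A : 'M[R]_(p, m)) (i j : 'I_p)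
    (l : 'I_m) : bool :=
  (A i l != 0) && (A j l != 0).

Definition one_latent_component {R : realType} (p m : nat) (A : 'M[R]_(p, m))
    (i j : 'I_p) : Prop :=
  #|[set l | shared A i j l]%SET| = 1%N.

(* Main.v *)
Require Import Defs.
From HB Require Import structures.
From mathcomp Require Import all_boot all_order all_algebra.
From mathcomp Require Import ring.

Set Implicit Arguments.
Unset Strict Implicit.
Unset Printing Implicit Defensive.
Import Order.TTheory GRing.Theory Num.Theory.

Local Open Scope ring_scope.

(* Cumulants are multilinear and the joint cumulants of independent sources
   vanish unless all arguments coincide. Hence, with a = A i k, b = A j k and
   kappa the fourth cumulant of the only shared source S k,
     cum(Xi, Xj) = a b, cum(Xi, Xi, Xj, Xj) = a^2 b^2 kappa,
     cum(Xi, Xj, Xj, Xj) = a b^3 kappa,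
   and the formula follows. The fourth moment of a source used by Xi or Xj is
   not assumed: it is deduced from that of the mixture by conditioning on the
   other sources being bounded. *)

(** * Cumulants of orders two and four of centred variables *)

(** The two fourth cumulants have ratio a / b, and multiplying by a b leaves a^2. This needs kappa
    to cancel, and kappa <> 0 is read off from the nonvanishing of the denominator a b^3 kappa.
    Fourth moments alone would not do: besides the diagonal terms they contain the pairings a = b, c
    = d and their two analogues, which bring in the variances of unshared sources. The three
    partitions into pairs in the cumulant remove exactly these terms. Independence is a statement
    about events. The product rule for expectations is reached by exchanging indicators for general
    functions, one source at a time. For nonnegative functions the basic factorization is proved in
    the extended reals, with no integrability assumed on the exchanged function; this is what allows
    the finiteness of the fourth moment of a source to be a conclusion. *)

Lemma set_neqC (T : finType) (B : {set T}) : B != set0 -> B != ~: B.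
Proof.
by move=> /set0Pn[x xB]; apply/eqP => /setP/(_ x); rewrite inE xB.
Qed.

Lemma partition_setC (T : finType) (B : {set T}) :
  B != set0 -> ~: B != set0 -> partition [set B; ~: B] [set: T].
Proof.
move=> B0 BC0; apply/and3P; split.
- by rewrite /cover big_setU1 ?inE ?set_neqC//= big_set1 setUCr.
- apply/trivIsetP => A C; rewrite !inE.
  move=> /orP[]/eqP-> /orP[]/eqP->; rewrite ?eqxx// => _.
    by rewrite -setI_eq0 setICr.
  by rewrite -setI_eq0 setIC setICr.
- by rewrite !inE negb_or ![set0 == _]eq_sym B0.
Qed.

Lemma partition_set1T (T : finType) : [set: T] != set0 ->
  partition [set [set: T]] [set: T].
Proof.
move=> T0; apply/and3P; split; first by rewrite /cover big_set1.
  by apply/trivIsetP => A C /set1P-> /set1P->; rewrite eqxx.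
by rewrite inE eq_sym.
Qed.

Section partitions_of_four.

Let o0 : 'I_4 := inord 0.
Let o1 : 'I_4 := inord 1.
Let o2 : 'I_4 := inord 2.
Let o3 : 'I_4 := inord 3.

Lemma ord4P (x : 'I_4) : [\/ x = inord 0, x = inord 1, x = inord 2 | x = inord 3].
Proof.
rewrite -[x]inord_val; case: x => -[|[|[|[|//]]]] /= _.
- by constructor 1.
- by constructor 2.
- by constructor 3.
- by constructor 4.
Qed.

Lemma inord4_eq a b : (a < 4)%N -> (b < 4)%N ->
  ((inord a : 'I_4) == inord b) = (a == b).
Proof. by move=> a4 b4; rewrite -val_eqE /= !inordK. Qed.

(** Without singletons every block has at least two of the four positions. Either the block of 0 is
    everything, or it has exactly two elements and its complement is the only other block, so that
    the partner of 0 determines [D]. *)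
Lemma partition4P (D : {set {set 'I_4}}) : partition D [set: 'I_4] ->
  (forall x, [set x] \notin D) ->
  [\/ D = [set [set: 'I_4]],
      D = [set [set o0; o1]; ~: [set o0; o1]],
      D = [set [set o0; o2]; ~: [set o0; o2]] |
      D = [set [set o0; o3]; ~: [set o0; o3]]].
Proof.
move=> pD D1; have /and3P[/eqP covD tD D0] := pD.
have blk x : pblock D x \in D by apply: pblock_mem; rewrite covD inE.
have memblk x : x \in pblock D x by rewrite mem_pblock covD inE.
have card_blk A : A \in D -> (1 < #|A|)%N.
  move=> AD; rewrite ltn_neqAle eq_sym card_gt0; apply/andP; split.
    by apply/negP => /cards1P[x Ax]; move: (D1 x); rewrite -Ax AD.
  by apply: contraNneq D0 => <-.
pose B := pblock D o0.
have [BT|/subsetPn[x _ xB]] := boolP ([set: 'I_4] \subset B).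
  constructor 1; apply/setP => A; rewrite inE.
  have BE : B = setT by apply/eqP; rewrite eqEsubset subsetT.
  apply/idP/eqP => [AD|->]; last by rewrite -BE blk.
  have /card_gt0P[y yA] : (0 < #|A|)%N by apply: ltnW; exact: card_blk.
  by rewrite -(def_pblock tD AD yA) -BE; apply: same_pblock => //; rewrite -/B BE.
pose C := pblock D x.
have dBC : [disjoint B & C].
  apply: (trivIsetP tD); rewrite ?blk//.
  by apply: contraNneq xB => ->; exact: memblk.
have [cB cC] := (card_blk _ (blk o0), card_blk _ (blk x)).
have cBC : (#|B| + #|C| <= 4)%N.
  rewrite -cardsUI (disjoint_setI0 dBC) cards0 addn0.
  by rewrite (leq_trans (max_card _))// card_ord.
have cB2 : #|B| = 2.
  by apply/eqP; rewrite eqn_leq cB -(leq_add2r 2) (leq_trans _ cBC)// leq_add2l.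
have CE : C = ~: B.
  apply/eqP; rewrite eqEcard -disjoints_subset disjoint_sym dBC/=.
  by rewrite cardsCs setCK card_ord cB2.
have DE : D = [set B; ~: B].
  apply/setP => A; rewrite !inE; apply/idP/orP => [AD|[/eqP->|/eqP->]]; last 2 first.
  - exact: blk.
  - by rewrite -CE blk.
  have /card_gt0P[y yA] : (0 < #|A|)%N by apply: ltnW; exact: card_blk.
  rewrite -(def_pblock tD AD yA).
  have [yB|yB] := boolP (y \in B).
    by left; rewrite (def_pblock tD (blk o0) yB).
  right; rewrite -CE; apply/eqP; apply: def_pblock => //; first exact: blk.
  by rewrite CE inE.
have B0 := memblk o0 : o0 \in B.
have [b bE] : exists b, B :\ o0 = [set b].
  by apply/cards1P; move: cB2; rewrite (cardsD1 o0 B) B0 add1n => -[] /eqP.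
have BE : B = [set o0; b] by rewrite -bE setD1K.
have nb : b != o0 by move/setP/(_ b): bE; rewrite !inE eqxx => /andP[].
rewrite DE BE.
have [b0|->|->|->] := ord4P b; last 3 first.
- by constructor 2.
- by constructor 3.
- by constructor 4.
by rewrite b0 eqxx in nb.
Qed.

(* [M B] stands for the moment of the block [B]; for centred variables the
   partitions with a singleton block do not contribute. *)
Lemma sum_partition4 (R : comRingType) (M : {set 'I_4} -> R) :
  (forall x, M [set x] = 0) ->
  \sum_(D : {set {set 'I_4}} | partition D [set: 'I_4])
    (-1) ^+ #|D|.-1 * (#|D|.-1)`!%:R * \prod_(B in D) M B =
  M [set: 'I_4] - M [set inord 0; inord 1] * M [set inord 2; inord 3]
  - M [set inord 0; inord 2] * M [set inord 1; inord 3]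
  - M [set inord 0; inord 3] * M [set inord 1; inord 2].
Proof.
move=> M1.
pose p b : {set {set 'I_4}} := [set [set o0; b]; ~: [set o0; b]].
have pT : partition [set [set: 'I_4]] [set: 'I_4].
  by apply: partition_set1T; apply/set0Pn; exists o0.
have pair0 b : [set o0; b] != set0 :> {set 'I_4}.
  by apply/set0Pn; exists o0; rewrite !inE eqxx.
have pp b c : c != o0 -> c != b -> partition (p b) [set: 'I_4].
  move=> c0 cb; apply: partition_setC => //.
  by apply/set0Pn; exists c; rewrite !inE negb_or c0.
have p_neqT b c : c != o0 -> c != b -> p b != [set [set: 'I_4]].
  move=> c0 cb; apply/eqP => /setP/(_ [set o0; b]).
  rewrite !inE eqxx /= => /esym/eqP/setP/(_ c).
  by rewrite !inE (negbTE c0) (negbTE cb).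
have p_neq b c : b != o0 -> b != c -> p b != p c.
  move=> b0 bc; apply/eqP => /setP/(_ [set o0; b]).
  rewrite !inE eqxx /= => /esym/orP[]/eqP/setP.
    by move=> /(_ b); rewrite !inE eqxx (negbTE b0) (negbTE bc).
  by move=> /(_ o0); rewrite !inE eqxx.
have term b : \prod_(B in p b) M B = M [set o0; b] * M (~: [set o0; b]).
  by rewrite big_setU1 ?inE ?set_neqC//= big_set1.
have cardp b : #|p b| = 2 by rewrite cards2 set_neqC.
rewrite (bigD1 [set [set: 'I_4]])//= cards1 big_set1 expr0 fact0 !mul1r.
rewrite (bigD1 (p o1))/=; last first.
  by rewrite (pp o1 o2) ?(p_neqT o1 o2)// inord4_eq.
rewrite (bigD1 (p o2))/=; last first.
  by rewrite (pp o2 o1) ?(p_neqT o2 o1) ?(p_neq o2 o1)// inord4_eq.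
rewrite (bigD1 (p o3))/=; last first.
  by rewrite (pp o3 o1) ?(p_neqT o3 o1) ?(p_neq o3 o1) ?(p_neq o3 o2)// inord4_eq.
rewrite [X in _ + (_ + (_ + (_ + X)))]big1; last first.
  move=> D /andP[/andP[/andP[/andP[pD DT] D1] D2] D3].
  have [/existsP[x xD]|/existsPn D_no1] := boolP [exists x, [set x] \in D].
    by rewrite (bigD1 [set x])//= M1 mul0r mulr0.
  have [DE|DE|DE|DE] := partition4P pD D_no1.
  - by rewrite DE eqxx in DT.
  - by rewrite DE eqxx in D1.
  - by rewrite DE eqxx in D2.
  - by rewrite DE eqxx in D3.
have C01 : ~: [set o0; o1] = [set o2; o3].
  by apply/setP => x; have [->|->|->|->] := ord4P x; rewrite !inE !inord4_eq.
have C02 : ~: [set o0; o2] = [set o1; o3].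
  by apply/setP => x; have [->|->|->|->] := ord4P x; rewrite !inE !inord4_eq.
have C03 : ~: [set o0; o3] = [set o1; o2].
  by apply/setP => x; have [->|->|->|->] := ord4P x; rewrite !inE !inord4_eq.
rewrite addr0 !term !cardp C01 C02 C03 /= expr1 mulr1 !mulN1r.
by rewrite !addrA.
Qed.

End partitions_of_four.

Lemma sum_partition2 (R : comRingType) (M : {set 'I_2} -> R) :
  (forall x, M [set x] = 0) ->
  \sum_(D : {set {set 'I_2}} | partition D [set: 'I_2])
    (-1) ^+ #|D|.-1 * (#|D|.-1)`!%:R * \prod_(B in D) M B = M [set: 'I_2].
Proof.
move=> M1; have T0 : [set: 'I_2] != set0 by apply/set0Pn; exists ord0.
rewrite (bigD1 [set [set: 'I_2]])/=; last exact: partition_set1T.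
rewrite cards1 big_set1 expr0 fact0 !mul1r big1 ?addr0// => D /andP[pD DT].
have [/existsP[x xD]|/existsPn D1] := boolP [exists x, [set x] \in D].
  by rewrite (bigD1 [set x])//= M1 mul0r mulr0.
have /and3P[/eqP covD tD D0] := pD.
case/eqP: DT; apply/setP => A; rewrite inE.
(* A block that is neither empty nor a singleton fills the two positions. *)
have full B : B \in D -> B = setT.
  move=> BD; apply/eqP; rewrite eqEcard subsetT cardsT card_ord/=.
  rewrite ltn_neqAle eq_sym card_gt0; apply/andP; split.
    by apply/negP => /cards1P[x Bx]; move: (D1 x); rewrite -Bx BD.
  by apply: contraNneq D0 => <-.
apply/idP/eqP => [/full//|->].
have : pblock D ord0 \in D by apply: pblock_mem; rewrite covD inE.
by move=> /[dup] /full ->.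
Qed.

(** * Fourth-order moments of independent sources *)

(** Rewrites a product of chosen sources as a monomial over all sources, the exponent of [l]
    counting how often [l] is chosen. Equal sources are thereby collected before independence is
    applied. *)
Lemma prod_exp_delta (R : comRingType) (m : nat) (x : 'I_m -> R) (a : 'I_m) :
  \prod_l x l ^+ (a == l) = x a.
Proof.
rewrite (bigD1 a)//= eqxx expr1 big1 ?mulr1// => l la.
by rewrite eq_sym (negbTE la) expr0.
Qed.

Lemma sum_delta (R : comRingType) (m : nat) (F : 'I_m -> R) (a : 'I_m) :
  \sum_l (a == l)%:R * F l = F a.
Proof.
rewrite (bigD1 a)//= eqxx mul1r big1 ?addr0// => l la.
by rewrite eq_sym (negbTE la) mul0r.
Qed.

Lemma prod_moment2 (R : comRingType) (m : nat) (mu : 'I_m -> nat -> R)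
    (a b : 'I_m) :
  (forall l, mu l 0 = 1) -> (forall l, mu l 1 = 0) ->
  \prod_l mu l ((a == l) + (b == l))%N = (a == b)%:R * mu a 2.
Proof.
move=> mu0 mu1; rewrite (bigD1 a)//= eqxx.
have [<-|ab] := eqVneq a b; last by rewrite mu1 !mul0r.
rewrite mul1r big1 ?mulr1// => l la.
by rewrite eq_sym (negbTE la) mu0.
Qed.

(* [mu l n] is the [n]-th moment of the [l]-th source. *)
Lemma prod_moment4 (R : comRingType) (m : nat) (mu : 'I_m -> nat -> R)
    (a b c d : 'I_m) :
  (forall l, mu l 0 = 1) -> (forall l, mu l 1 = 0) ->
  \prod_l mu l ((a == l) + (b == l) + (c == l) + (d == l))%N =
  (a == b)%:R * (c == d)%:R * mu a 2 * mu c 2 +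
  (a == c)%:R * (b == d)%:R * mu a 2 * mu b 2 +
  (a == d)%:R * (b == c)%:R * mu a 2 * mu b 2 +
  (a == b)%:R * (a == c)%:R * (a == d)%:R * (mu a 4 - 3 * mu a 2 ^+ 2).
Proof.
move=> mu0 mu1.
(* An index occurring exactly once contributes a vanishing first moment, so only two pairs or a
   fourfold coincidence survive. *)
have isolated (e : 'I_m -> nat) x : e x = 1%N -> \prod_l mu l (e l) = 0.
  by move=> ex; rewrite (bigD1 x)//= ex mu1 mul0r.
have pairs (e : 'I_m -> nat) x y : x != y -> e x = 2 -> e y = 2 ->
    (forall l, l != x -> l != y -> e l = 0%N) ->
    \prod_l mu l (e l) = mu x 2 * mu y 2.
  move=> xy ex ey e0; rewrite (bigD1 x)//= ex (bigD1 y)/= 1?eq_sym// ey.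
  by rewrite big1 ?mulr1// => l /andP[lx ly]; rewrite e0 ?mu0.
have nE (x y : 'I_m) : x != y -> ((x == y) = false) * ((y == x) = false).
  by move=> /negbTE xy; rewrite [y == x]eq_sym xy.
have [<-{b}|/nE ab] := eqVneq a b.
  have [<-{c}|/nE ac] := eqVneq a c.
    have [<-{d}|/nE ad] := eqVneq a d.
      (* When all four indices agree, each of the three pairings contributes [mu a 2 ^+ 2]; the
         coefficient 3 in the last term cancels them and leaves [mu a 4]. *)
      rewrite (bigD1 a)//= eqxx big1 => [|l /nE la]; last by rewrite !la mu0.
      by rewrite /=; ring.
    by rewrite (@isolated _ d); rewrite ?eqxx ?ad//=; ring.
  have [<-{d}|/nE cd] := eqVneq c d.
    rewrite (@pairs _ a c); rewrite ?eqxx ?ac//; first by rewrite /=; ring.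
    by move=> l /nE la /nE lc; rewrite !la !lc.
  by rewrite (@isolated _ c); rewrite ?eqxx ?ac ?cd//=; ring.
have [<-{c}|/nE ac] := eqVneq a c.
  have [<-{d}|/nE bd] := eqVneq b d.
    rewrite (@pairs _ a b); rewrite ?eqxx ?ab//; first by rewrite /=; ring.
    by move=> l /nE la /nE lb; rewrite !la !lb.
  by rewrite (@isolated _ b); rewrite ?eqxx ?ab ?bd//=; ring.
have [<-{d}|/nE ad] := eqVneq a d.
  have [<-{c} {ac}|/nE bc] := eqVneq b c.
    rewrite (@pairs _ a b); rewrite ?eqxx ?ab//; first by rewrite /=; ring.
    by move=> l /nE la /nE lb; rewrite !la !lb.
  by rewrite (@isolated _ b); rewrite ?eqxx ?ab ?bc//=; ring.
by rewrite (@isolated _ a); rewrite ?eqxx ?ab ?ac ?ad//=; ring.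
Qed.

(** With [v] the variances and [k] the fourth cumulants of the sources, this evaluates the fourth
    mixed moment of four combinations. Each pairing of indices factors into a product of two
    covariances, and the total diagonal carries [k]. *)
Lemma sum_moment4 (R : comRingType) (m : nat) (v k x y z t : 'I_m -> R) :
  \sum_a \sum_b \sum_c \sum_d x a * y b * z c * t d *
    ((a == b)%:R * (c == d)%:R * v a * v c +
     (a == c)%:R * (b == d)%:R * v a * v b +
     (a == d)%:R * (b == c)%:R * v a * v b +
     (a == b)%:R * (a == c)%:R * (a == d)%:R * k a) =
  (\sum_l x l * y l * v l) * (\sum_l z l * t l * v l) +
  (\sum_l x l * z l * v l) * (\sum_l y l * t l * v l) +
  (\sum_l x l * t l * v l) * (\sum_l y l * z l * v l) +
  \sum_l x l * y l * z l * t l * k l.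
Proof.
rewrite !big_distrlr -!big_split; apply: eq_bigr => a _ /=.
transitivity (\sum_b \sum_c ((a == b)%:R * (x a * y b * z c * t c * v a * v c) +
   (a == c)%:R * (x a * y b * z c * t b * v a * v b) +
   (b == c)%:R * (x a * y b * z c * t a * v a * v b) +
   (a == b)%:R * ((a == c)%:R * (x a * y b * z c * t a * k a)))).
  apply: eq_bigr => b _; apply: eq_bigr => c _.
  under eq_bigr do rewrite mulrDr mulrDr mulrDr.
  rewrite !big_split /=; congr (_ + _ + _ + _).
  - rewrite -(sum_delta (fun d => (a == b)%:R * (x a * y b * z c * t d * v a * v c))).
    by apply: eq_bigr => d _; ring.
  - rewrite -(sum_delta (fun d => (a == c)%:R * (x a * y b * z c * t d * v a * v b))).
    by apply: eq_bigr => d _; ring.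
  - rewrite -(sum_delta (fun d => (b == c)%:R * (x a * y b * z c * t d * v a * v b))).
    by apply: eq_bigr => d _; ring.
  - rewrite -(sum_delta
      (fun d => (a == b)%:R * ((a == c)%:R * (x a * y b * z c * t d * k a)))).
    by apply: eq_bigr => d _; ring.
transitivity (\sum_b ((a == b)%:R * \sum_c (x a * y b * z c * t c * v a * v c) +
   x a * y b * z a * t b * v a * v b + x a * y b * z b * t a * v a * v b +
   (a == b)%:R * (x a * y b * z a * t a * k a))).
  apply: eq_bigr => b _.
  by rewrite !big_split /= -!mulr_sumr !sum_delta.
rewrite !big_split /= !sum_delta; congr (_ + _ + _ + _).
- by apply: eq_bigr => c _; ring.
- by apply: eq_bigr => c _; ring.
- by apply: eq_bigr => c _; ring.
Qed.

From mathcomp Require Import all_classical all_reals all_analysis.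
From mathcomp Require Import measurable_realfun.

Import numFieldNormedType.Exports HBNNSimple.

Local Open Scope classical_set_scope.

(** * Product rule for expectations of independent variables *)

(** Extends the factorization from indicators to [f] by simple functions and monotone convergence.
    Keeping [G] abstract serves both a product of functions of the other sources and a truncation
    event; the integral of [f] may be infinite. *)
Lemma ge0_integral_factor (R : realType) (disp : measure_display)
    (T : measurableType disp) (P : probability T R) (Y : {RV P >-> R})
    (G : T -> R) (c : R) (f : R -> R) :
  measurable_fun setT G -> (forall w, 0 <= G w) -> 0 <= c ->
  (forall B, measurable B ->
    \int[P]_w (\1_B (Y w) * G w)%:E = P (Y @^-1` B) * c%:E)%E ->
  measurable_fun setT f -> (forall x, 0 <= f x) ->
  (\int[P]_w (f (Y w) * G w)%:E = (\int[P]_w (f (Y w))%:E) * c%:E)%E.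
Proof.
move=> mG G0 c0 PG mf f0.
have /measurable_EFinP mEf := mf.
pose h := nnsfun_approx measurableT mEf.
have hf x : (h n x)%:E @[n --> \oo] --> (f x)%:E.
  by apply: (cvg_nnsfun_approx measurableT mEf) => // y _; rewrite lee_fin.
have nd_h x m n : (m <= n)%N -> h m x <= h n x.
  by move=> mn; exact/lefP/nd_nnsfun_approx.
have mhY n : measurable_fun setT (fun w => h n (Y w)).
  by apply: measurableT_comp.
have intfG : (\int[P]_w (h n (Y w) * G w)%:E @[n --> \oo] -->
    \int[P]_w (f (Y w) * G w)%:E)%E.
  have -> : (\int[P]_w (f (Y w) * G w)%:E =
      \int[P]_w limn (fun n => (h n (Y w) * G w)%:E))%E.
    apply: eq_integral => w _; apply/esym/cvg_lim => //.
    under eq_fun do rewrite EFinM; rewrite EFinM.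
    by apply: cvgeZr => //; exact: hf.
  apply: cvg_monotone_convergence => //.
  - by move=> n; apply/measurable_EFinP; apply: measurable_funM.
  - by move=> n w _; rewrite lee_fin mulr_ge0.
  - by move=> w _ m n mn; rewrite lee_fin ler_wpM2r// nd_h.
have intf : (\int[P]_w (h n (Y w))%:E @[n --> \oo] -->
    \int[P]_w (f (Y w))%:E)%E.
  have -> : (\int[P]_w (f (Y w))%:E =
      \int[P]_w limn (fun n => (h n (Y w))%:E))%E.
    by apply: eq_integral => w _; apply/esym/cvg_lim => //; exact: hf.
  apply: cvg_monotone_convergence => //.
  - by move=> n; exact/measurable_EFinP.
  - by move=> n w _; rewrite lee_fin.
  - by move=> w _ m n mn; rewrite lee_fin nd_h.
have hG n : (\int[P]_w (h n (Y w) * G w)%:E =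
    \int[P]_w (h n (Y w))%:E * c%:E)%E.
  have [s hE] : exists s : seq R, forall w, h n w = \sum_(y <- s)
      y * \1_(h n @^-1` [set y]) w.
    by eexists=> w; rewrite fimfunE fsbig_finite.
  have y0 y w : 0 <= y * \1_(h n @^-1` [set y]) w.
    by have := nnfun_muleindic_ge0 (h n) y w; rewrite lee_fin.
  have my y : measurable_fun setT (fun w => \1_(h n @^-1` [set y]) (Y w) : R).
    by apply: measurableT_comp => //; exact: measurable_indic.
  under eq_integral do rewrite hE mulr_suml -sumEFin.
  rewrite ge0_integral_sum//; last 2 first.
  - move=> y; apply/measurable_EFinP; apply: measurable_funM => //.
    by apply: measurable_funM.
  - by move=> y w _; rewrite lee_fin mulr_ge0.
  under [in RHS]eq_integral do rewrite hE -sumEFin.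
  rewrite [in RHS]ge0_integral_sum//; last 2 first.
  - by move=> y; apply/measurable_EFinP; exact: measurable_funM.
  - by move=> y w _; rewrite lee_fin.
  rewrite ge0_sume_distrl; last first.
    by move=> y _; apply: integral_ge0 => w _; rewrite lee_fin.
  apply: eq_bigr => y _.
  (* The sum runs over a bare list of values, while pulling out the scalar [y] requires [0 <= y]; a
     negative [y] has an empty level set because [h n] is nonnegative. *)
  have [y_lt0|y_ge0] := ltP y 0.
    have -> : h n @^-1` [set y] = set0.
      apply/seteqP; split => // x /= hx.
      by move: y_lt0; rewrite -hx ltNge fun_ge0.
    under eq_integral do rewrite indic0 mulr0 mul0r.
    under [in RHS]eq_integral do rewrite indic0 mulr0.
    by rewrite integral0 mul0e.
  under eq_integral do rewrite -mulrA EFinM.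
  rewrite ge0_integralZl_EFin//; last 2 first.
  - by move=> w _; rewrite lee_fin mulr_ge0.
  - by apply/measurable_EFinP; exact: measurable_funM.
  rewrite PG//; under [in RHS]eq_integral do rewrite EFinM.
  rewrite ge0_integralZl_EFin//; last exact/measurable_EFinP.
  rewrite -muleA; congr (_ * (_ * _))%E.
  rewrite (_ : (fun w => _) = (fun w => (\1_(Y @^-1` (h n @^-1` [set y])) w)%:E))//.
  rewrite integral_indic ?setIT//.
  rewrite -[X in measurable X]setTI; exact: (measurable_funPT Y).
move: intfG; under eq_fun do rewrite hG.
move/cvg_lim => <- //; apply/cvg_lim => //.
exact: cvgeZr.
Qed.

Lemma measurable_RV_comp (R : realType) (disp : measure_display)
    (T : measurableType disp) (P : probability T R) (Y : {RV P >-> R})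
    (f : R -> R) :
  measurable_fun setT f -> measurable_fun setT (fun w => f (Y w)).
Proof. by move=> mf; apply: measurableT_comp. Qed.

Lemma measurable_preimage_RV (R : realType) (disp : measure_display)
    (T : measurableType disp) (P : probability T R) (Y : {RV P >-> R})
    (B : set R) : measurable B -> measurable (Y @^-1` B).
Proof. by move=> mB; rewrite -[X in measurable X]setTI; exact: (measurable_funPT Y). Qed.

Lemma integral_prod_indic (R : realType) (disp : measure_display)
    (T : measurableType disp) (P : probability T R) (m : nat)
    (S : 'I_m -> {RV P >-> R}) (B : 'I_m -> set R) :
  mutually_independent P S -> (forall l, measurable (B l)) ->
  (\int[P]_w (\prod_l \1_(B l) (S l w))%:E = \prod_l P (S l @^-1` B l))%E.
Proof.
move=> indS mB.
have := indS [set: 'I_m]%SET B mB.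
rewrite (eq_bigl xpredT) => [<-|l]; last by rewrite finset.in_setT.
rewrite -[X in P X]setIT -integral_indic//; last first.
  by apply: fin_bigcap_measurable => // l _; exact: measurable_preimage_RV.
apply: eq_integral => w _; congr (_%:E).
have [Bw|nBw] := pselect (forall l, B l (S l w)).
  rewrite big1 => [|l _]; last by rewrite indicE mem_set.
  by rewrite indicE mem_set// => l _; exact: Bw.
have [l nl] : exists l, ~ B l (S l w) by exact/existsNP.
rewrite indicE memNset; last first.
  by apply: contra_not nl => /(_ l); apply; rewrite /= finset.in_setT.
by rewrite (bigD1 l)//= indicE memNset// mul0r.
Qed.

(** Induction on a list [s] outside which every [f l] is an indicator. The empty list is
    independence itself, and each step frees one more factor. *)
Lemma ge0_integral_prod (R : realType) (disp : measure_display)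
    (T : measurableType disp) (P : probability T R) (m : nat)
    (S : 'I_m -> {RV P >-> R}) (f : 'I_m -> R -> R) (r : 'I_m -> R) :
  mutually_independent P S ->
  (forall l, measurable_fun setT (f l)) -> (forall l x, 0 <= f l x) ->
  (forall l, \int[P]_w (f l (S l w))%:E = (r l)%:E)%E ->
  (\int[P]_w (\prod_l f l (S l w))%:E = (\prod_l r l)%:E)%E.
Proof.
move=> indS.
have r_ge0 (g : 'I_m -> R -> R) (q : 'I_m -> R) : (forall l x, 0 <= g l x) ->
    (forall l, \int[P]_w (g l (S l w))%:E = (q l)%:E)%E -> forall l, 0 <= q l.
  by move=> g0 gq l; rewrite -lee_fin -gq integral_ge0// => w _; rewrite lee_fin.
suff H (s : seq 'I_m) : forall (f : 'I_m -> R -> R) (r : 'I_m -> R),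
    (forall l, measurable_fun setT (f l)) -> (forall l x, 0 <= f l x) ->
    (forall l, \int[P]_w (f l (S l w))%:E = (r l)%:E)%E ->
    (forall l, l \notin s -> exists2 B, measurable B & f l = \1_B) ->
    (\int[P]_w (\prod_l f l (S l w))%:E = (\prod_l r l)%:E)%E.
  move=> mf f0 fr; apply: (H (enum 'I_m)) => // l.
  by rewrite mem_enum.
elim: s => [|a s IH] {}f {}r mf f0 fr fB.
  have /choice[B mB] : forall l, exists B, measurable B /\ f l = \1_B.
    by move=> l; have [//|B mB ->] := fB l; exists B.
  under eq_integral do under eq_bigr => l _ do rewrite (mB l).2.
  rewrite integral_prod_indic//; last by move=> l; have [] := mB l.
  rewrite -prodEFin; apply: eq_bigr => l _.
  rewrite -fr -[X in P X]setIT -integral_indic//; last first.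
    by apply: measurable_preimage_RV; have [] := mB l.
  by rewrite (mB l).2.
have mG : measurable_fun setT (fun w => \prod_(l | l != a) f l (S l w)).
  under eq_fun do rewrite -big_filter.
  by apply: measurable_prod => l _; exact: measurable_RV_comp.
under eq_integral do rewrite (bigD1 a)//=.
rewrite [in RHS](bigD1 a)//= EFinM -fr.
apply: ge0_integral_factor => //.
- by move=> w; apply: prodr_ge0.
- by apply: prodr_ge0 => l _; exact: (r_ge0 f r).
move=> B mB.
(* Putting [\1_B] in place of [f a] removes [a] from the list, so the induction hypothesis supplies
   the indicator case required by [ge0_integral_factor]. *)
pose f' l := if l == a then \1_B else f l.
pose r' l := if l == a then fine (P (S a @^-1` B)) else r l.
have f'r' l : (\int[P]_w (f' l (S l w))%:E = (r' l)%:E)%E.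
  rewrite /f' /r'; case: eqP => [->|//].
  rewrite fineK ?fin_num_measure//; last exact: measurable_preimage_RV.
  rewrite -[X in P X]setIT -integral_indic//.
  exact: measurable_preimage_RV.
have : (\int[P]_w (\prod_l f' l (S l w))%:E = (\prod_l r' l)%:E)%E.
  apply: IH => //.
  - by move=> l; rewrite /f'; case: eqP => // _; exact: measurable_indic.
  - by move=> l x; rewrite /f'; case: eqP.
  - move=> l ls; rewrite /f'; case: eqP => [_|/eqP la]; first by exists B.
    by apply: fB; rewrite inE negb_or la.
have f'E w : \prod_l f' l (S l w) =
    \1_B (S a w) * \prod_(l | l != a) f l (S l w).
  rewrite (bigD1 a)//= {1}/f' eqxx; congr (_ * _).
  by apply: eq_bigr => l la; rewrite /f' (negbTE la).
under eq_integral do rewrite f'E.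
move=> ->; rewrite (bigD1 a)//= {1}/r' eqxx EFinM fineK; last first.
  by rewrite fin_num_measure//; exact: measurable_preimage_RV.
congr (_ * _%:E)%E.
by apply: eq_bigr => l la; rewrite /r' (negbTE la).
Qed.

(** Again an induction on a list, now of the indices at which [f l] may take negative values; the
    product is linear in each factor, so one factor can be split into its positive and negative
    parts. *)
Lemma integral_prod_indep (R : realType) (disp : measure_display)
    (T : measurableType disp) (P : probability T R) (m : nat)
    (S : 'I_m -> {RV P >-> R}) (f : 'I_m -> R -> R) (r : 'I_m -> R) :
  mutually_independent P S ->
  (forall l, measurable_fun setT (f l)) ->
  (forall l, P.-integrable setT (fun w => (f l (S l w))%:E)) ->
  (forall l, \int[P]_w (f l (S l w))%:E = (r l)%:E)%E ->
  P.-integrable setT (fun w => (\prod_l f l (S l w))%:E) /\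
  (\int[P]_w (\prod_l f l (S l w))%:E = (\prod_l r l)%:E)%E.
Proof.
move=> indS.
have mprod (g : 'I_m -> R -> R) : (forall l, measurable_fun setT (g l)) ->
    measurable_fun setT (fun w => \prod_l g l (S l w)).
  by move=> mg; apply: measurable_prod => l _; exact: measurable_RV_comp.
suff H (s : seq 'I_m) : forall (f : 'I_m -> R -> R) (r : 'I_m -> R),
    (forall l, measurable_fun setT (f l)) ->
    (forall l, P.-integrable setT (fun w => (f l (S l w))%:E)) ->
    (forall l, \int[P]_w (f l (S l w))%:E = (r l)%:E)%E ->
    (forall l, l \notin s -> forall x, 0 <= f l x) ->
    P.-integrable setT (fun w => (\prod_l f l (S l w))%:E) /\
    (\int[P]_w (\prod_l f l (S l w))%:E = (\prod_l r l)%:E)%E.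
  move=> mf fi fr; apply: (H (enum 'I_m)) => // l.
  by rewrite mem_enum.
elim: s => [|a s IH] {}f {}r mf fi fr f0.
  have fE : (\int[P]_w (\prod_l f l (S l w))%:E = (\prod_l r l)%:E)%E.
    by apply: ge0_integral_prod => // l; exact: f0.
  split => //; apply/integrableP; split.
    by apply/measurable_EFinP; exact: mprod.
  rewrite (_ : integral _ _ _ = (\prod_l r l)%:E) ?ltry// -fE.
  apply: eq_integral => w _; rewrite abse_EFin ger0_norm//.
  by apply: prodr_ge0 => l _; exact: f0.
(* For [e] equal to 1 or -1, the factor at [a] becomes the positive or the negative part of [f a];
   the other factors are unchanged. *)
pose part (e : R) l x := if l == a then Num.max (e * f l x) 0 else f l x.
pose q e l := fine (\int[P]_w (part e l (S l w))%:E).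
have mpart e l : measurable_fun setT (part e l).
  rewrite /part; case: eqP => // _; apply: measurable_maxr => //.
  exact: measurable_funM.
have ipart e l : `|e| = 1 -> P.-integrable setT (fun w => (part e l (S l w))%:E).
  move=> e1; apply: (le_integrable measurableT _ _ (fi l)) => [|w _].
    by apply/measurable_EFinP; exact: measurable_RV_comp.
  rewrite lee_fin /part; case: eqP => // _.
  rewrite ger0_norm ?le_max ?lexx ?orbT// ge_max normr_ge0 andbT.
  by rewrite (le_trans (ler_norm _))// normrM e1 mul1r.
have IHe e : `|e| = 1 ->
    P.-integrable setT (fun w => (\prod_l part e l (S l w))%:E) /\
    (\int[P]_w (\prod_l part e l (S l w))%:E = (\prod_l q e l)%:E)%E.
  move=> e1; apply: IH => //.
  - by move=> l; exact: ipart.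
  - by move=> l; rewrite /q fineK// integrable_fin_num//; exact: ipart.
  - move=> l ls x; rewrite /part; case: eqP => [_|/eqP la].
      by rewrite le_max lexx orbT.
    by apply: f0; rewrite inE negb_or la.
have [i1 E1] := IHe 1 (normr1 _).
have [i2 E2] := IHe (-1) (normrN1 _).
have faE x : f a x = part 1 a x - part (-1) a x.
  rewrite /part eqxx mul1r mulN1r; case: (lerP 0 (f a x)) => h.
    by rewrite max_r ?oppr_le0// subr0.
  by rewrite max_l ?oppr_ge0 1?ltW// sub0r opprK.
have restE e w : \prod_(l | l != a) part e l (S l w) =
    \prod_(l | l != a) f l (S l w).
  by apply: eq_bigr => l la; rewrite /part (negbTE la).
have splita (F : 'I_m -> R) : \prod_l F l = F a * \prod_(l | l != a) F l.
  by rewrite (bigD1 a).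
have fE w : \prod_l f l (S l w) =
    \prod_l part 1 l (S l w) - \prod_l part (-1) l (S l w).
  by rewrite !splita !restE -mulrBl -faE.
have raE : r a = q 1 a - q (-1) a.
  apply: EFin_inj; rewrite -fr EFinB /q !fineK ?integrable_fin_num//; last 2 first.
  - by apply: ipart; rewrite normrN1.
  - by apply: ipart; rewrite normr1.
  rewrite -integralB_EFin//; last 2 first.
  - by apply: ipart; rewrite normr1.
  - by apply: ipart; rewrite normrN1.
  by apply: eq_integral => w _; rewrite faE.
have qE e : \prod_(l | l != a) q e l = \prod_(l | l != a) r l.
  by apply: eq_bigr => l la; rewrite /q /part (negbTE la) fr.
have -> : \prod_l r l = \prod_l q 1 l - \prod_l q (-1) l.
  by rewrite !splita !qE -mulrBl -raE.
have -> : (fun w => (\prod_l f l (S l w))%:E) =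
    (fun w => (\prod_l part 1 l (S l w))%:E - (\prod_l part (-1) l (S l w))%:E)%E.
  by apply/funext => w; rewrite fE EFinB.
rewrite integralB_EFin// E1 E2 -EFinB; split => //.
exact: integrableB.
Qed.

(** * Integrability of the summands of an independent sum *)

Lemma measurable_normr_le (R : realType) (M : R) :
  measurable [set x : R | `|x| <= M].
Proof.
rewrite (_ : mkset _ = `[-M, M]%classic); first exact: measurable_itv.
by apply/seteqP; split => x /=; rewrite in_itv/= ler_norml.
Qed.

(** Otherwise the whole space would be a countable union of null events. *)
Lemma exists_bounded_event (R : realType) (disp : measure_display)
    (T : measurableType disp) (P : probability T R) (Y : {RV P >-> R}) :
  exists M : R, P (Y @^-1` [set x | `|x| <= M]) != 0%E.
Proof.
apply: contrapT => /forallNP H.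
have H0 n : P (Y @^-1` [set x | `|x| <= n%:R]) = 0%E.
  by apply/eqP/negPn/negP => h; exact: (H n%:R).
have : P.-negligible (\bigcup_n (Y @^-1` [set x | `|x| <= n%:R])).
  apply: negligible_bigcup => n.
  apply/negligibleP; last exact: H0.
  by apply: measurable_preimage_RV; exact: measurable_normr_le.
have -> : \bigcup_n (Y @^-1` [set x | `|x| <= n%:R]) = [set: T].
  apply/seteqP; split => // w _; exists (Num.truncn `|Y w|).+1 => //=.
  exact: ltW (truncnS_gt _).
move/(measure_negligible measurableT).
by rewrite [LHS]probability_setT => /eqP; rewrite onee_eq0.
Qed.

Lemma subX4_le (R : realFieldType) (x y : R) :
  (x - y) ^+ 4 <= 8 * (x ^+ 4 + y ^+ 4).
Proof.
rewrite -subr_ge0.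
(* With u = x - y and v = x + y, 8 (x^4 + y^4) = u^4 + 6 u^2 v^2 + v^4. *)
rewrite (_ : _ - _ = 6 * ((x - y) ^+ 2 * (x + y) ^+ 2) + (x + y) ^+ 4); last by ring.
apply: addr_ge0; last exact: exprn_even_ge0.
apply: mulr_ge0; first exact: ler0n.
by apply: mulr_ge0; exact: sqr_ge0.
Qed.

(* On the event that all other sources are bounded, which is independent of
   [S k] and has positive probability, [S k] is dominated by [X] and a constant. *)
Lemma integrableX4_summand (R : realType) (disp : measure_display)
    (T : measurableType disp) (P : probability T R) (m : nat)
    (S : 'I_m -> {RV P >-> R}) (c : 'I_m -> R) (X : T -> R) (k : 'I_m) :
  mutually_independent P S -> (forall w, X w = \sum_l c l * S l w) ->
  P.-integrable setT (fun w => (X w ^+ 4)%:E) -> c k != 0 ->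
  P.-integrable setT (fun w => (S k w ^+ 4)%:E).
Proof.
move=> indS XE iX ck0.
have X4_ge0 (x : R) : 0 <= x ^+ 4 by exact: exprn_even_ge0.
have /choice[M PM] := fun l => exists_bounded_event (S l).
pose B l := [set x : R | `|x| <= M l].
have mB l : measurable (B l) by exact: measurable_normr_le.
have Pfin l A : measurable A -> P (S l @^-1` A) \is a fin_num.
  by move=> mA; rewrite fin_num_measure//; exact: measurable_preimage_RV.
(* [G] is the indicator of the event that every source other than [S k] stays within its bound, and
   [c0] is the probability of that event. *)
pose G w : R := \prod_(l | l != k) \1_(B l) (S l w).
pose c0 := \prod_(l | l != k) fine (P (S l @^-1` B l)).
have c0_gt0 : 0 < c0.
  apply: prodr_gt0 => l _; rewrite lt_neqAle fine_ge0// andbT eq_sym.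
  by rewrite fine_eq0// ?PM// Pfin.
have mG : measurable_fun setT G.
  rewrite /G; under eq_fun do rewrite -big_filter.
  apply: measurable_prod => l _; apply: measurable_RV_comp.
  exact: measurable_indic.
have G_ge0 w : 0 <= G w by apply: prodr_ge0.
have mX4 : measurable_fun setT (fun w => S k w ^+ 4).
  by apply: measurable_funX; exact: measurable_funPT.
have SG : (\int[P]_w (S k w ^+ 4 * G w)%:E =
    (\int[P]_w (S k w ^+ 4)%:E) * c0%:E)%E.
  apply: (ge0_integral_factor (f := fun x => x ^+ 4)) => //; first exact: ltW.
  - move=> A mA.
    pose B' l := if l == k then A else B l.
    have mB' l : measurable (B' l) by rewrite /B'; case: eqP.
    have := integral_prod_indic indS mB'.
    rewrite (bigD1 k)//= {2}/B' eqxx => H.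
    transitivity (\int[P]_w (\prod_l \1_(B' l) (S l w))%:E)%E.
      apply: eq_integral => w _; rewrite (bigD1 k)//= {1}/B' eqxx; congr (_ * _)%:E.
      by apply: eq_bigr => l lk; rewrite /B' (negbTE lk).
    rewrite H; congr (_ * _)%E; rewrite /c0 -prodEFin; apply: eq_bigr => l lk.
    by rewrite /B' (negbTE lk) fineK// Pfin.
(* On that event [D] bounds the contribution r of the other sources to [X]. Since c k S k = X - r,
   [subX4_le] gives the factor 8 in [K], and dividing by [c k ^+ 4] gives the rest. *)
pose D := \sum_(l | l != k) `|c l| * M l.
pose K := 8 / c k ^+ 4.
have ck4 : 0 < c k ^+ 4 by rewrite lt_neqAle X4_ge0 eq_sym expf_neq0.
have dom w : S k w ^+ 4 * G w <= K * (X w ^+ 4 + D ^+ 4).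
  have [BS|nBS] := pselect (forall l, l != k -> B l (S l w)); last first.
    have [l /not_implyP[lk nl]] := (existsNP _).2 nBS.
    rewrite /G (bigD1 l)//= indicE memNset// mul0r mulr0.
    by rewrite mulr_ge0 ?divr_ge0 ?addr_ge0 ?X4_ge0.
  rewrite /G big1 ?mulr1 => [|l lk]; last by rewrite indicE mem_set//; exact: BS.
  pose r := \sum_(l | l != k) c l * S l w.
  have rD : `|r| <= D.
    apply: (le_trans (ler_norm_sum _ _ _)); apply: ler_sum => l lk.
    by rewrite normrM ler_wpM2l//; exact: BS.
  rewrite /K mulrAC ler_pdivlMr// -exprMn.
  have -> : S k w * c k = X w - r by rewrite XE (bigD1 k)//= addrK mulrC.
  apply: (le_trans (subX4_le _ _)); rewrite ler_wpM2l// lerD2l.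
  rewrite -(ger0_norm (X4_ge0 r)) normrX.
  by rewrite lerXn2r ?nnegrE// (le_trans _ rD).
have iD : P.-integrable setT (fun w => (K * (X w ^+ 4 + D ^+ 4))%:E).
  under eq_fun do rewrite EFinM EFinD.
  apply: integrableZl => //; apply: integrableD => //.
  exact: finite_measure_integrable_cst.
have iSG : P.-integrable setT (fun w => (S k w ^+ 4 * G w)%:E).
  apply: (le_integrable measurableT _ _ iD) => [|w _].
    by apply/measurable_EFinP; exact: measurable_funM.
  have SG_ge0 : 0 <= S k w ^+ 4 * G w by exact: mulr_ge0.
  by rewrite lee_fin ger0_norm// (le_trans (dom w))// ler_norm.
apply/integrableP; split; first exact/measurable_EFinP.
under eq_integral do rewrite abse_EFin ger0_norm//.
(* The product of the fourth moment with [c0 > 0] is finite, which excludes an infinite fourth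
   moment. *)
have := integrable_fin_num measurableT iSG; rewrite SG.
have : (0 <= \int[P]_w (S k w ^+ 4)%:E)%E.
  by apply: integral_ge0 => w _; rewrite lee_fin.
case: (\int[P]_w (S k w ^+ 4)%:E)%E => //=.
  by move=> r _ _; exact: ltry.
by rewrite gt0_mulye ?lte_fin.
Qed.

(** * Cumulants of linear combinations of independent sources *)

(** Linearity of the integral needs each term to be integrable, so integrability is carried along
    with the value. *)
Definition has_expectation (R : realType) (disp : measure_display)
    (T : measurableType disp) (P : probability T R) (X : T -> R) (x : R) :=
  P.-integrable setT (fun w => (X w)%:E) /\ (\int[P]_w (X w)%:E = x%:E)%E.

Lemma has_expectation_fine (R : realType) (disp : measure_display)
    (T : measurableType disp) (P : probability T R) (X : T -> R) (x : R) :
  has_expectation P X x -> fine ('E_P[X])%E = x.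
Proof. by move=> [_ EX]; rewrite unlock EX. Qed.

Lemma has_expectationZ (R : realType) (disp : measure_display)
    (T : measurableType disp) (P : probability T R) (X : T -> R) (x k : R) :
  has_expectation P X x -> has_expectation P (fun w => k * X w) (k * x).
Proof.
move=> [iX EX]; split; first by under eq_fun do rewrite EFinM; exact: integrableZl.
by under eq_integral do rewrite EFinM; rewrite integralZl// EX.
Qed.

Lemma has_expectation_sum (R : realType) (disp : measure_display)
    (T : measurableType disp) (P : probability T R) (I : finType)
    (F : I -> T -> R) (x : I -> R) :
  (forall i, has_expectation P (F i) (x i)) ->
  has_expectation P (fun w => \sum_i F i w) (\sum_i x i).
Proof.
move=> FE; rewrite /has_expectation.
have -> : (fun w => (\sum_i F i w)%:E) = (fun w => \sum_i (F i w)%:E)%E.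
  by apply/funext => w; rewrite sumEFin.
split; first by apply: integrable_sum => // i _; exact: (FE i).1.
rewrite integral_sum//; last by move=> i; exact: (FE i).1.
by rewrite -sumEFin; apply: eq_bigr => i _; exact: (FE i).2.
Qed.

Lemma cum2E (R : realType) (disp : measure_display)
    (T : measurableType disp) (P : probability T R) (Y0 Y1 : {RV P >-> R}) :
  fine ('E_P[Y0])%E = 0 -> fine ('E_P[Y1])%E = 0 ->
  cum P [tuple Y0; Y1] = fine ('E_P[fun w => (Y0 w * Y1 w)%R])%E.
Proof.
move=> E0 E1; rewrite /cum sum_partition2.
  congr (fine ('E_P[_]))%E; apply/funext => w.
  rewrite (eq_bigl xpredT) => [|l]; last by rewrite inE.
  by rewrite !big_ord_recl big_ord0 mulr1.
move=> x; transitivity (fine ('E_P[tnth [tuple Y0; Y1] x])%E).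
  by congr (fine ('E_P[_]))%E; apply/funext => w; rewrite big_set1.
by case: x => -[|[|//]] /= ?; rewrite (tnth_nth Y0).
Qed.

Lemma cum4E (R : realType) (disp : measure_display)
    (T : measurableType disp) (P : probability T R)
    (Y0 Y1 Y2 Y3 : {RV P >-> R}) :
  let E2 (X Y : T -> R) := fine ('E_P[fun w => (X w * Y w)%R])%E in
  fine ('E_P[Y0])%E = 0 -> fine ('E_P[Y1])%E = 0 ->
  fine ('E_P[Y2])%E = 0 -> fine ('E_P[Y3])%E = 0 ->
  cum P [tuple Y0; Y1; Y2; Y3] =
  fine ('E_P[fun w => (Y0 w * Y1 w * Y2 w * Y3 w)%R])%E
  - E2 Y0 Y1 * E2 Y2 Y3 - E2 Y0 Y2 * E2 Y1 Y3 - E2 Y0 Y3 * E2 Y1 Y2.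
Proof.
move=> E2 E0 E1 E'2 E3.
have YE a w : (a < 4)%N -> tnth [tuple Y0; Y1; Y2; Y3] (inord a) w =
    nth Y0 [:: Y0; Y1; Y2; Y3] a w.
  by move=> a4; rewrite (tnth_nth Y0) /= inordK.
have pairE a b : (a < 4)%N -> (b < 4)%N -> a != b ->
    (fun w => \prod_(l in [set inord a; inord b]%SET)
      tnth [tuple Y0; Y1; Y2; Y3] l w) =
    (fun w => nth Y0 [:: Y0; Y1; Y2; Y3] a w * nth Y0 [:: Y0; Y1; Y2; Y3] b w).
  move=> a4 b4 ab; apply/funext => w.
  by rewrite big_setU1 ?finset.inE ?inord4_eq//= big_set1 !YE.
rewrite /cum sum_partition4.
  rewrite !pairE//=; congr (fine ('E_P[_])%E - _ - _ - _); apply/funext => w.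
  rewrite (eq_bigl xpredT) => [|l]; last by rewrite finset.inE.
  by rewrite !big_ord_recl big_ord0 mulr1 !mulrA.
move=> x; transitivity (fine ('E_P[tnth [tuple Y0; Y1; Y2; Y3] x])%E).
  by congr (fine ('E_P[_]))%E; apply/funext => w; rewrite big_set1.
by case: x => -[|[|[|[|//]]]] /= ?; rewrite (tnth_nth Y0).
Qed.

(** Domination by |y|^n <= 1 + y^p, where the evenness of [p] makes y^p nonnegative. *)
Lemma integrableX_le (R : realType) (disp : measure_display)
    (T : measurableType disp) (P : probability T R) (Y : {RV P >-> R})
    (n p : nat) : (n <= p)%N -> ~~ odd p ->
  P.-integrable setT (fun w => (Y w ^+ p)%:E) ->
  P.-integrable setT (fun w => (Y w ^+ n)%:E).
Proof.
move=> np podd iYp.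
have i1 : P.-integrable setT (fun w => (1 + Y w ^+ p)%:E).
  under eq_fun do rewrite EFinD; apply: integrableD => //.
  exact: finite_measure_integrable_cst.
apply: (le_integrable measurableT _ _ i1) => [|w _].
  by apply/measurable_EFinP; apply: measurable_funX; exact: measurable_funPT.
have Yp0 : 0 <= Y w ^+ p by exact: exprn_even_ge0.
rewrite lee_fin (le_trans _ (ler_norm _))// normrX -(ger0_norm Yp0) normrX.
have [Y1|Y1] := leP `|Y w| 1.
  by rewrite (le_trans (exprn_ile1 _ _ Y1))// lerDl exprn_ge0.
by rewrite (le_trans (ler_weXn2l (ltW Y1) np))// lerDr.
Qed.

Lemma has_expectation_monomial (R : realType) (disp : measure_display)
    (T : measurableType disp) (P : probability T R) (m : nat)
    (S : 'I_m -> {RV P >-> R}) (e : 'I_m -> nat) :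
  mutually_independent P S ->
  (forall l, P.-integrable setT (fun w => (S l w ^+ 4)%:E)) ->
  (forall l, (e l <= 4)%N) ->
  has_expectation P (fun w => \prod_l S l w ^+ e l)
    (\prod_l fine ('E_P[fun w => (S l w ^+ e l)%R])%E).
Proof.
move=> indS S4 e4.
apply: (integral_prod_indep (f := fun l x => x ^+ e l)) => // l.
- exact: integrableX_le (S4 l).
- rewrite unlock fineK// integrable_fin_num//.
  exact: integrableX_le (S4 l).
Qed.

Section linear_combinations.
Variables (R : realType) (disp : measure_display) (T : measurableType disp).
Variables (P : probability T R) (m : nat) (S : 'I_m -> {RV P >-> R}).
Hypothesis indS : mutually_independent P S.
Hypothesis S4 : forall l, P.-integrable setT (fun w => (S l w ^+ 4)%:E).
Hypothesis S0 : forall l, fine ('E_P[S l])%E = 0.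

Let mu l n := fine ('E_P[fun w => (S l w ^+ n)%R])%E.

Let mu0 l : mu l 0 = 1.
Proof. by rewrite /mu; under eq_fun do rewrite expr0; rewrite expectation_cst. Qed.

Let mu1 l : mu l 1 = 0.
Proof. by rewrite -[RHS](S0 l); congr (fine ('E_P[_])%E). Qed.

Lemma expectation_lin1 (Y : T -> R) (c : 'I_m -> R) :
  (forall w, Y w = \sum_l c l * S l w) -> fine ('E_P[Y])%E = 0.
Proof.
move=> /funext ->; apply: has_expectation_fine.
rewrite -[X in has_expectation _ _ X](_ : \sum_l c l * 0 = 0); last first.
  by rewrite big1// => l _; rewrite mulr0.
apply: has_expectation_sum => l; apply: has_expectationZ.
have iS : P.-integrable setT (fun w => (S l w ^+ 1)%:E).
  exact: integrableX_le (S4 l).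
split; first exact: iS.
have := S0 l; rewrite unlock => S0l; rewrite -[X in X%:E]S0l fineK//.
exact: integrable_fin_num iS.
Qed.

Lemma expectation_lin2 (Y Z : T -> R) (c d : 'I_m -> R) :
  (forall w, Y w = \sum_l c l * S l w) ->
  (forall w, Z w = \sum_l d l * S l w) ->
  fine ('E_P[fun w => (Y w * Z w)%R])%E = \sum_l c l * d l * mu l 2.
Proof.
move=> YE ZE; apply: has_expectation_fine.
have -> : (fun w => Y w * Z w) =
    (fun w => \sum_a \sum_b c a * d b * \prod_l S l w ^+ ((a == l) + (b == l))).
  apply/funext => w; rewrite YE ZE big_distrlr.
  apply: eq_bigr => a _; apply: eq_bigr => b _.
  under [in RHS]eq_bigr do rewrite exprD.
  by rewrite big_split /= !prod_exp_delta; ring.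
have -> : \sum_l c l * d l * mu l 2 = \sum_a \sum_b c a * d b *
    \prod_l mu l ((a == l) + (b == l))%N.
  apply: eq_bigr => a _.
  rewrite -(sum_delta (fun b => c a * d b * mu a 2)).
  by apply: eq_bigr => b _; rewrite prod_moment2//; ring.
apply: has_expectation_sum => a; apply: has_expectation_sum => b.
apply: has_expectationZ; apply: has_expectation_monomial => // l.
by case: (a == l); case: (b == l).
Qed.

Lemma expectation_lin4 (X Y Z W : T -> R) (c d e f : 'I_m -> R) :
  (forall w, X w = \sum_l c l * S l w) ->
  (forall w, Y w = \sum_l d l * S l w) ->
  (forall w, Z w = \sum_l e l * S l w) ->
  (forall w, W w = \sum_l f l * S l w) ->
  fine ('E_P[fun w => (X w * Y w * Z w * W w)%R])%E =
  \sum_a \sum_b \sum_c' \sum_d' c a * d b * e c' * f d' *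
    \prod_l mu l ((a == l) + (b == l) + (c' == l) + (d' == l))%N.
Proof.
move=> XE YE ZE WE; apply: has_expectation_fine.
have -> : (fun w => X w * Y w * Z w * W w) =
    (fun w => \sum_a \sum_b \sum_c' \sum_d' c a * d b * e c' * f d' *
    \prod_l S l w ^+ ((a == l) + (b == l) + (c' == l) + (d' == l))).
  apply/funext => w; rewrite XE YE ZE WE -!mulrA big_distrlr.
  rewrite mulr_suml; apply: eq_bigr => a _.
  rewrite mulrA mulr_sumr mulr_suml; apply: eq_bigr => b _ /=.
  rewrite mulr_sumr; apply: eq_bigr => c' _.
  rewrite mulr_sumr; apply: eq_bigr => d' _.
  under [in RHS]eq_bigr do rewrite !exprD.
  by rewrite !big_split /= !prod_exp_delta; ring.
do 4![apply: has_expectation_sum => ?].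
apply: has_expectationZ; apply: has_expectation_monomial => // l.
by do 4![case: (_ == l)].
Qed.

Lemma cum2_linear (Y0 Y1 : {RV P >-> R}) (c0 c1 : 'I_m -> R) :
  (forall w, Y0 w = \sum_l c0 l * S l w) ->
  (forall w, Y1 w = \sum_l c1 l * S l w) ->
  cum P [tuple Y0; Y1] = \sum_l c0 l * c1 l * mu l 2.
Proof.
move=> E0 E1.
rewrite cum2E ?(expectation_lin1 E0) ?(expectation_lin1 E1)//.
exact: expectation_lin2.
Qed.

(** The three products of covariances subtracted in [cum4E] cancel the three pairings in the fourth
    moment. What remains is weighted by [mu l 4 - 3 * mu l 2 ^+ 2], the fourth cumulant of the
    centred source [S l]. *)
Lemma cum4_linear (Y0 Y1 Y2 Y3 : {RV P >-> R}) (c0 c1 c2 c3 : 'I_m -> R) :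
  (forall w, Y0 w = \sum_l c0 l * S l w) ->
  (forall w, Y1 w = \sum_l c1 l * S l w) ->
  (forall w, Y2 w = \sum_l c2 l * S l w) ->
  (forall w, Y3 w = \sum_l c3 l * S l w) ->
  cum P [tuple Y0; Y1; Y2; Y3] =
  \sum_l c0 l * c1 l * c2 l * c3 l * (mu l 4 - 3 * mu l 2 ^+ 2).
Proof.
move=> E0 E1 E2 E3.
rewrite cum4E ?(expectation_lin1 E0) ?(expectation_lin1 E1)
  ?(expectation_lin1 E2) ?(expectation_lin1 E3)//.
rewrite (expectation_lin2 E0 E1) (expectation_lin2 E2 E3).
rewrite (expectation_lin2 E0 E2) (expectation_lin2 E1 E3).
rewrite (expectation_lin2 E0 E3) (expectation_lin2 E1 E2).
rewrite (expectation_lin4 E0 E1 E2 E3).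
under eq_bigr do under eq_bigr do under eq_bigr do under eq_bigr do
  rewrite prod_moment4//.
by rewrite (sum_moment4 (mu ^~ 2)); ring.
Qed.

End linear_combinations.

(** * Transformed sources and the identification of the coefficients *)

Lemma mutually_independent_comp (R : realType) (disp : measure_display)
    (T : measurableType disp) (P : probability T R) (m : nat)
    (S Z : 'I_m -> {RV P >-> R}) (f : 'I_m -> R -> R) :
  mutually_independent P S -> (forall l, measurable_fun setT (f l)) ->
  (forall l w, Z l w = f l (S l w)) -> mutually_independent P Z.
Proof.
move=> indS mf ZE J B mB.
have ZB l : Z l @^-1` B l = S l @^-1` (f l @^-1` B l).
  by apply/funext => w /=; rewrite ZE.
under eq_bigcapr do rewrite ZB.
under eq_bigr do rewrite ZB.
apply: (indS J (fun l => f l @^-1` B l)) => l.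
by rewrite -[X in measurable X]setTI; exact: mf.
Qed.

Lemma Lfun4_integrableX4 (R : realType) (disp : measure_display)
    (T : measurableType disp) (P : probability T R) (X : T -> R) :
  X \in Lfun P 4%:E -> P.-integrable setT (fun w => (X w ^+ 4)%:E).
Proof.
move=> X4; have : 1 <= 4 :> R by rewrite ler1n.
move=> /Lfun_integrable/(_ X4).
under eq_fun => w.
  rewrite powR_mulrn// -normrX ger0_norm; last exact: exprn_even_ge0.
  over.
by [].
Qed.

(* S k is determined only up to sign, so the coefficients identified are those of
   the component Num.sg (A i k) * S k, i.e. of S k oriented so that its
   coefficient in X i is positive. *)
Theorem theorem2p3 (R : realType) (disp : measure_display)
    (T : measurableType disp) (P : probability T R) (p m : nat) (hpm : (p < m)%N)
    (A : 'M[R]_(p, m)) (S : 'I_m -> {RV P >-> R}) (X : 'I_p -> {RV P >-> R})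
    (hX : linear_model P A S X)
    (hindep : mutually_independent P S)
    (hmean : forall l, zero_mean P (S l))
    (i j : 'I_p) (hij : i != j)
    (hXi : (X i : T -> R) \in Lfun P 4%:E)
    (hXj : (X j : T -> R) \in Lfun P 4%:E)
    (hone : one_latent_component A i j)
    (k : 'I_m) (hk : shared A i j k)
    (hgauss : ~ gaussian P (S k))
    (hvar : ('V_P[S k] = 1)%E)
    (hcum : cum P [tuple X i; X j; X j; X j] != 0) :
  let ai := Num.sg (A i k) * A i k in
  let aj := Num.sg (A i k) * A j k in
  ai = Num.sqrt (cum P [tuple X i; X i; X j; X j] / cum P [tuple X i; X j; X j; X j]
                 * cum P [tuple X i; X j]) /\
  aj = cum P [tuple X i; X j] / ai.
Proof.
have XE q w : X q w = \sum_l A q l * S l w.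
  have /colP/(_ q) := hX w; rewrite !mxE => ->.
  by apply: eq_bigr => l _; rewrite mxE.
have ES l : fine ('E_P[S l])%E = 0 by rewrite (hmean l).2.
(* Sources absent from both mixtures may have no fourth moment, so they are
   replaced by zero. *)
pose b l : R := ((A i l != 0) || (A j l != 0))%:R.
pose Z l : {RV P >-> R} := (b l \o* S l)%R.
have ZE l w : Z l w = b l * S l w by rewrite /= mulrC.
have indZ : mutually_independent P Z.
  apply: (mutually_independent_comp (f := fun l x => b l * x) hindep) => // l.
  exact: measurable_funM.
have XZE q : q \in [:: i; j] -> forall w, X q w = \sum_l A q l * Z l w.
  move=> qij w; rewrite XE; apply: eq_bigr => l _; rewrite ZE mulrA; congr (_ * _).
  rewrite /b; move: qij; rewrite !inE => /orP[]/eqP->.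
    by have [->|_] := eqVneq (A i l) 0; rewrite ?mul0r// mulr1.
  by have [->|_] := eqVneq (A j l) 0; rewrite ?mul0r// orbT mulr1.
have XiE := XZE i (mem_head _ _).
have XjE : forall w, X j w = \sum_l A j l * Z l w.
  by apply: XZE; rewrite !inE eqxx orbT.
have Z4 l : P.-integrable setT (fun w => (Z l w ^+ 4)%:E).
  under eq_fun do rewrite ZE exprMn EFinM.
  rewrite /b; have [Ail|Ail] := eqVneq (A i l) 0; last first.
    apply: integrableZl => //.
    exact: integrableX4_summand hindep (XE i) (Lfun4_integrableX4 hXi) Ail.
  have [Ajl|Ajl] := eqVneq (A j l) 0; last first.
    apply: integrableZl => //.
    exact: integrableX4_summand hindep (XE j) (Lfun4_integrableX4 hXj) Ajl.
  rewrite expr0n/=; under eq_fun do rewrite mul0e.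
  exact: integrable0.
have EZ l : fine ('E_P[Z l])%E = 0.
  by rewrite expectationZl ?(hmean l).1// (hmean l).2 mule0.
have /andP[aik ajk] := hk.
(* Every cumulant below sums terms divisible by [A i l * A j l], so only the shared index [k]
   contributes. *)
have uniq_k l : l != k -> A i l * A j l = 0.
  move=> lk; apply/eqP; rewrite mulf_eq0 -[_ || _]negbK negb_or.
  apply: contra lk => sh; have /eqP/cards1P[x xE] := hone.
  have : l \in [set l | shared A i j l]%SET by rewrite finset.inE.
  have : k \in [set l | shared A i j l]%SET by rewrite finset.inE.
  by rewrite xE !finset.inE => /eqP-> /eqP->.
have bk : b k = 1 by rewrite /b aik.
have sumk (F : 'I_m -> R) (G : 'I_m -> R) : (forall l, F l = A i l * A j l * G l) ->
    \sum_l F l = F k.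
  move=> FG; rewrite (bigD1 k)//= big1 ?addr0// => l lk.
  by rewrite FG uniq_k// mul0r.
have v1 : fine ('E_P[fun w => (Z k w ^+ 2)%R])%E = 1.
  have := hvar; rewrite /variance covariance.unlock ES => ES2.
  rewrite -[RHS]/(fine 1%E) -ES2; congr (fine ('E_P[_])%E).
  apply/funext => w; rewrite ZE bk mul1r expr2.
  by rewrite -[S k w]subr0.
set kap := (fine ('E_P[fun w => (Z k w ^+ 4)%R])%E -
  3 * fine ('E_P[fun w => (Z k w ^+ 2)%R])%E ^+ 2).
have c2 : cum P [tuple X i; X j] = A i k * A j k.
  rewrite (cum2_linear indZ Z4 EZ XiE XjE) (sumk _ _ (fun l => erefl)) v1.
  by rewrite mulr1.
have c31 : cum P [tuple X i; X j; X j; X j] = A i k * A j k ^+ 3 * kap.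
  rewrite (cum4_linear indZ Z4 EZ XiE XjE XjE XjE).
  rewrite (sumk _ (fun l => A j l ^+ 2 * (fine ('E_P[fun w => (Z l w ^+ 4)%R])%E -
    3 * fine ('E_P[fun w => (Z l w ^+ 2)%R])%E ^+ 2))); last by move=> l; ring.
  by rewrite -/kap; ring.
have c22 : cum P [tuple X i; X i; X j; X j] = A i k ^+ 2 * A j k ^+ 2 * kap.
  rewrite (cum4_linear indZ Z4 EZ XiE XiE XjE XjE).
  rewrite (sumk _ (fun l => A i l * A j l * (fine ('E_P[fun w => (Z l w ^+ 4)%R])%E -
    3 * fine ('E_P[fun w => (Z l w ^+ 2)%R])%E ^+ 2))); last by move=> l; ring.
  by rewrite -/kap; ring.
have kap0 : kap != 0.
  by move: hcum; rewrite c31; apply: contraNneq => ->; rewrite mulr0.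
move=> ai aj; have aiE : ai = `|A i k| by rewrite /ai -normrEsg.
split.
  (* The radicand reduces to [A i k ^+ 2], whose root is the absolute value. *)
  rewrite c22 c31 c2 aiE -sqrtr_sqr; congr Num.sqrt.
  by field; rewrite aik ajk kap0.
(* Writing [A i k] as its sign times its absolute value, division by the latter leaves the sign on
   [A j k]. *)
rewrite c2 aiE /aj {2}[A i k]numEsg.
by rewrite mulrAC mulfK ?normr_eq0.
Qed.
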